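(* Let $\sigma$ be a countable signature. Let $L(\sigma)$ be the least set of formulas containing all atomic first-order $\sigma$-formulas and a new atomic sentence $P$ and closed under the first-order connectives and quantifiers. Define $\models_{L(\sigma)}$ as for first-order logic, with the additional clause $\mathcal M\models_{L(\sigma)}P$ if and only if $|\mathrm{Aut}(\mathcal M)|\leq2^{\aleph_0}$. Then $L(\sigma)>FO(\sigma)$, and $L(\sigma)$ has the $\aleph_0$-compactness property.
   Context: $\mathrm{Aut}(\mathcal M)$ is the automorphism group of $\mathcal M$. For an abstract logic $L(\sigma)$ (a set of sentences with an isomorphism-invariant satisfaction relation to $\sigma$-structures), a class of structures is expressible if some sentence is satisfied exactly by its members; $L(\sigma)\geq FO(\sigma)$ means every class expressible in first-order logic is expressible in $L(\sigma)$, and $L(\sigma)>FO(\sigma)$ means additionally that some class expressible in $L(\sigma)$ is not first-order expressible. $\aleph_0$-compactness: every countable set of sentences all of whose finite subsets have a model has a model. *)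

(* Defs.v *)
From Stdlib Require Import Arith List Classical.
From Stdlib Require Fin.
Set Implicit Arguments.

Record signature : Type := {
  funs : Type; rels : Type;
  fun_ar : funs -> nat; rel_ar : rels -> nat }.

Definition countable_signature (s : signature) : Prop :=
  (exists ef : funs s -> nat, forall f g, ef f = ef g -> f = g) /\
  (exists er : rels s -> nat, forall r q, er r = er q -> r = q).

Inductive term (s : signature) : Type :=
| tvar : nat -> term s
| tfun : forall f : funs s, (Fin.t (fun_ar s f) -> term s) -> term s.

Inductive form (s : signature) : Type :=
| fFalse : form s
| fEq : term s -> term s -> form s
| fRel : forall r : rels s, (Fin.t (rel_ar s r) -> term s) -> form s
| fP : form s
| fNot : form s -> form s
| fAnd : form s -> form s -> form s
| fOr : form s -> form s -> form s
| fImp : form s -> form s -> form s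
| fAll : nat -> form s -> form s
| fEx : nat -> form s -> form s.

Arguments tvar {s}. Arguments fFalse {s}. Arguments fP {s}.

Fixpoint occurs s (x : nat) (t : term s) : Prop :=
  match t with
  | tvar y => x = y
  | tfun f a => exists i, occurs x (a i)
  end.

Fixpoint free s (x : nat) (p : form s) : Prop :=
  match p with
  | fFalse | fP => False
  | fEq t1 t2 => occurs x t1 \/ occurs x t2
  | fRel r a => exists i, occurs x (a i)
  | fNot q => free x q
  | fAnd q1 q2 | fOr q1 q2 | fImp q1 q2 => free x q1 \/ free x q2
  | fAll y q | fEx y q => x <> y /\ free x q
  end.

Definition sentence s (p : form s) : Prop := forall x, ~ free x p.

Fixpoint P_free s (p : form s) : Prop :=
  match p with
  | fP => False
  | fFalse | fEq _ _ | fRel _ _ => True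
  | fNot q | fAll _ q | fEx _ q => P_free q
  | fAnd q1 q2 | fOr q1 q2 | fImp q1 q2 => P_free q1 /\ P_free q2
  end.

Definition FO_sentence s (p : form s) : Prop := sentence p /\ P_free p.

Record structure (s : signature) : Type := {
  dom : Type;
  dom_inh : inhabited dom;
  fint : forall f : funs s, (Fin.t (fun_ar s f) -> dom) -> dom;
  rint : forall r : rels s, (Fin.t (rel_ar s r) -> dom) -> Prop }.

Definition is_aut s (M : structure s) (g : dom M -> dom M) : Prop :=
  (exists ginv : dom M -> dom M, forall x, ginv (g x) = x /\ g (ginv x) = x) /\
  (forall f a, g (fint M f a) = fint M f (fun i => g (a i))) /\
  (forall r a, rint M r a <-> rint M r (fun i => g (a i))).

(* |Aut(M)| <= 2^aleph0 : Aut(M) injects into nat -> bool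
   (automorphisms identified up to extensional equality). *)
Definition aut_le_continuum s (M : structure s) : Prop :=
  exists h : (dom M -> dom M) -> (nat -> bool),
    forall g1 g2, is_aut M g1 -> is_aut M g2 ->
      (forall n, h g1 n = h g2 n) -> forall x, g1 x = g2 x.

Fixpoint eval s (M : structure s) (rho : nat -> dom M) (t : term s) : dom M :=
  match t with
  | tvar x => rho x
  | tfun f a => fint M f (fun i => eval M rho (a i))
  end.

Definition upd s (M : structure s) (rho : nat -> dom M) (x : nat) (d : dom M) :=
  fun y => if Nat.eqb y x then d else rho y.

Fixpoint sat s (M : structure s) (rho : nat -> dom M) (p : form s) : Prop :=
  match p with
  | fFalse => False
  | fEq t1 t2 => eval M rho t1 = eval M rho t2
  | fRel r a => rint M r (fun i => eval M rho (a i))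
  | fP => aut_le_continuum M
  | fNot q => ~ sat M rho q
  | fAnd q1 q2 => sat M rho q1 /\ sat M rho q2
  | fOr q1 q2 => sat M rho q1 \/ sat M rho q2
  | fImp q1 q2 => sat M rho q1 -> sat M rho q2
  | fAll x q => forall d, sat M (upd M rho x d) q
  | fEx x q => exists d, sat M (upd M rho x d) q
  end.

Definition models s (M : structure s) (p : form s) : Prop :=
  forall rho, sat M rho p.

Definition L_expressible s (K : structure s -> Prop) : Prop :=
  exists p, sentence p /\ forall M, K M <-> models M p.

Definition FO_expressible s (K : structure s -> Prop) : Prop :=
  exists p, FO_sentence p /\ forall M, K M <-> models M p.

Definition L_stronger_than_FO (s : signature) : Prop :=
  (forall K : structure s -> Prop, FO_expressible K -> L_expressible K) /\
  (exists K : structure s -> Prop, L_expressible K /\ ~ FO_expressible K).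

Definition aleph0_compact (s : signature) : Prop :=
  forall T : form s -> Prop,
    (forall p, T p -> sentence p) ->
    (exists e : form s -> nat, forall p q, T p -> T q -> e p = e q -> p = q) ->
    (forall l : list (form s), (forall p, In p l -> T p) ->
        exists M : structure s, forall p, In p l -> models M p) ->
    exists M : structure s, forall p, T p -> models M p.

(* Main.v *)
(** A compactness argument needs, for a sequence [M n] of infinite models, a limit
model with more than continuum many automorphisms. It is obtained as an ultrapower
iterated along a linear order [I]: fix a free ultrafilter [U] on [nat]; the elements
are the functions [f n x] with [x : I -> nat] and values in [M n] that depend on
finitely many coordinates of [x], and [f], [g] are identified if [f n x = g n x] for
[U]-almost all [n], [U]-almost all [x i1], ..., [U]-almost all [x ik], where
[i1 < ... < ik] are the relevant coordinates. The theorem of Los holds, automorphisms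
of [I] act on the limit, and the coordinates [x i] give distinct elements, so [Aut I]
embeds into the automorphism group. Take for [I] a sum of continuum many copies of [Z].

Compactness: if every finite part of [T] has a model of [P], the limit has a countable
elementary substructure, in which [P] holds; otherwise every finite part has a model of
the negation of [P], which is then infinite, and the limit itself refutes [P].

[P] is not first-order: it holds in a countable infinite structure and fails in the
limit of the constant sequence of that structure. *)

Require Import Defs.
From Stdlib Require Import Arith List Classical.
From Stdlib Require Import Lia ZArith Sorted Cantor.
From Stdlib Require Import ClassicalEpsilon FunctionalExtensionality
  PropExtensionality ProofIrrelevance.
From mathcomp Require filter.
Set Implicit Arguments.
Unset Asymmetric Patterns.

(** * Formulas without [P] *)

Section CoreFormulas.
Variable s : signature.

Inductive cform : Type :=
| cFalse : cform
| cEq : term s -> term s -> cform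
| cRel : forall r : rels s, (Fin.t (rel_ar s r) -> term s) -> cform
| cNot : cform -> cform
| cAnd : cform -> cform -> cform
| cEx : nat -> cform -> cform.

Fixpoint csat (M : structure s) (rho : nat -> dom M) (p : cform) : Prop :=
  match p with
  | cFalse => False
  | cEq t1 t2 => eval M rho t1 = eval M rho t2
  | cRel r a => rint M r (fun i => eval M rho (a i))
  | cNot q => ~ csat M rho q
  | cAnd q1 q2 => csat M rho q1 /\ csat M rho q2
  | cEx x q => exists d, csat M (upd M rho x d) q
  end.

(** [P] has one truth value per structure, so wherever that value is [b] it can be replaced by a
    constant. Los's theorem and elementarity then concern first-order formulas only. *)
Fixpoint core (b : bool) (p : form s) : cform :=
  match p with
  | fFalse => cFalse
  | fEq t1 t2 => cEq t1 t2
  | fRel r a => cRel r a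
  | fP => if b then cNot cFalse else cFalse
  | fNot q => cNot (core b q)
  | fAnd q1 q2 => cAnd (core b q1) (core b q2)
  | fOr q1 q2 => cNot (cAnd (cNot (core b q1)) (cNot (core b q2)))
  | fImp q1 q2 => cNot (cAnd (core b q1) (cNot (core b q2)))
  | fAll x q => cNot (cEx x (cNot (core b q)))
  | fEx x q => cEx x (core b q)
  end.

(** The first alternative serves first-order sentences, for either [b]; the second serves structures
    in which [P] has the value [b]. *)
Lemma core_sat (b : bool) (M : structure s) (p : form s) :
  P_free p \/ (b = true <-> aut_le_continuum M) ->
  forall rho, csat M rho (core b p) <-> sat M rho p.
Proof.
  induction p as [|t1 t2|r a| |q IH|q1 IH1 q2 IH2|q1 IH1 q2 IH2|q1 IH1 q2 IH2|x q IH|x q IH];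
    simpl; intros Hb rho; try tauto.
  - destruct b; simpl; intuition discriminate.
  - rewrite IH; tauto.
  - rewrite IH1, IH2; tauto.
  - rewrite IH1, IH2; tauto.
  - rewrite IH1, IH2; tauto.
  - split.
    + intros H d. apply IH; [exact Hb|].
      apply NNPP. intro Hn. apply H. now exists d.
    + intros H [d Hd]. apply Hd. now apply IH.
  - split; intros [d Hd]; exists d; now apply IH.
Qed.

Lemma Fin_list (k : nat) : exists l, forall i : Fin.t k, In i l.
Proof.
  induction k as [|k [l Hl]].
  - exists nil. intro i. exact (Fin.case0 _ i).
  - exists (Fin.F1 :: map Fin.FS l). intro i.
    apply (Fin.caseS' i); simpl; auto using in_map.
Qed.

Lemma common_bound (k : nat) (P : Fin.t k -> nat -> Prop) :
  (forall i a b, a <= b -> P i a -> P i b) ->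
  (forall i, exists b, P i b) -> exists b, forall i, P i b.
Proof.
  intros Hmono H.
  destruct (Fin_list k) as [l Hl].
  assert (Hb : exists b, forall i, In i l -> P i b).
  { clear Hl. induction l as [|i l [b Hb]].
    - exists 0. intros i [].
    - destruct (H i) as [b' Hb']. exists (Nat.max b b').
      intros j [<-|Hj].
      + apply Hmono with b'; [lia|assumption].
      + apply Hmono with b; [lia|auto]. }
  destruct Hb as [b Hb]. exists b. auto.
Qed.

Lemma eval_bound (t : term s) : exists b, forall (M : structure s) rho rho',
  (forall k, k < b -> rho k = rho' k) -> eval M rho t = eval M rho' t.
Proof.
  induction t as [x|f a IH]; simpl.
  - exists (S x). auto.
  - destruct (common_bound (fun i b => forall (M : structure s) rho rho',
      (forall k, k < b -> rho k = rho' k) -> eval M rho (a i) = eval M rho' (a i)))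
      as [b Hb]; [|exact IH|].
    + intros i c d Hcd H M rho rho' Hr. apply H. intros k Hk. apply Hr. lia.
    + exists b. intros M rho rho' Hr. f_equal.
      extensionality i. now apply Hb.
Qed.

(** A semantic form of having finitely many free variables. The bound precedes the structure, so
    that one bound serves all [M n] at once; one implication suffices because the assumption on
    [rho] and [rho'] is symmetric. *)
Lemma csat_bound (p : cform) : exists b, forall (M : structure s) rho rho',
  (forall k, k < b -> rho k = rho' k) -> csat M rho p -> csat M rho' p.
Proof.
  induction p as [|t1 t2|r a|q [b Hb]|q1 [b1 H1] q2 [b2 H2]|x q [b Hb]]; simpl.
  - exists 0. auto.
  - destruct (eval_bound t1) as [b1 H1], (eval_bound t2) as [b2 H2].
    exists (b1 + b2). intros M rho rho' Hr E.
    rewrite <- (H1 M rho rho'), <- (H2 M rho rho'); auto;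
      intros k Hk; apply Hr; lia.
  - destruct (common_bound (fun i b => forall (M : structure s) rho rho',
      (forall k, k < b -> rho k = rho' k) -> eval M rho (a i) = eval M rho' (a i)))
      as [b Hb]; [|intro i; apply eval_bound|].
    + intros i c d Hcd H M rho rho' Hr. apply H. intros k Hk. apply Hr. lia.
    + exists b. intros M rho rho' Hr.
      replace (fun i => eval M rho' (a i)) with (fun i => eval M rho (a i)); auto.
      extensionality i. now apply Hb.
  - exists b. intros M rho rho' Hr H H'. apply H.
    revert H'. apply Hb. intros k Hk. symmetry. auto.
  - exists (b1 + b2). intros M rho rho' Hr [Ha Hc]. split.
    + revert Ha. apply H1. intros k Hk. apply Hr. lia.
    + revert Hc. apply H2. intros k Hk. apply Hr. lia.
  - exists b. intros M rho rho' Hr [d Hd]. exists d. revert Hd.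
    apply Hb. intros k Hk. unfold upd. destruct (Nat.eqb k x); auto.
Qed.

End CoreFormulas.

Arguments cFalse {s}.

(** * Iterated ultrafilters *)

Record free_ultrafilter (U : (nat -> Prop) -> Prop) : Prop := {
  fu_mono : forall A B : nat -> Prop, (forall n, A n -> B n) -> U A -> U B;
  fu_and : forall A B, U A -> U B -> U (fun n => A n /\ B n);
  fu_proper : ~ U (fun _ => False);
  fu_ultra : forall A, U A \/ U (fun n => ~ A n);
  fu_free : forall m, U (fun n => m < n) }.

(** Any ultrafilter extending the filter [E] of cofinite sets will do. *)
Lemma free_ultrafilter_exists : exists U, free_ultrafilter U.
Proof.
  set (E := fun A : nat -> Prop => exists m, forall n, m < n -> A n).
  assert (HE : filter.ProperFilter E).
  { constructor.
    - intros [m Hm]. exact (Hm (S m) (Nat.lt_succ_diag_r m)).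
    - constructor.
      + exists 0. intros; exact I.
      + intros A B [m Hm] [k Hk]. exists (m + k).
        intros n Hn. exact (conj (Hm n ltac:(lia)) (Hk n ltac:(lia))).
      + intros A B HAB [m Hm]. exists m. intros n Hn. exact (HAB n (Hm n Hn)). }
  destruct (filter.ultraFilterLemma HE) as [U [HU HEU]].
  assert (HF : filter.Filter U) by apply HU.
  exists U. constructor.
  - intros A B HAB. now apply (filter.filterS (F := U)).
  - intros A B HA HB. exact (filter.filterI HA HB).
  - exact (@filter.filter_not_empty _ U (@filter.ultra_proper _ U HU)).
  - intro A. exact (filter.in_ultra_setVsetC A HU).
  - intro m. apply HEU. exists m. auto.
Qed.

Section IteratedUltrafilter.
Variables (U : (nat -> Prop) -> Prop) (HU : free_ultrafilter U).
Variables (I : Type) (lt : I -> I -> Prop).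
Hypothesis lt_irrefl : forall i, ~ lt i i.
Hypothesis lt_trans : forall i j k, lt i j -> lt j k -> lt i k.
Hypothesis lt_total : forall i j, lt i j \/ i = j \/ lt j i.

Lemma U_all (A : nat -> Prop) : (forall n, A n) -> U A.
Proof. intro H. apply (fu_mono HU) with (2 := fu_free HU 0). auto. Qed.

Lemma U_const (P : Prop) : U (fun _ => P) <-> P.
Proof.
  split; [|intro H; now apply U_all].
  intro H. apply NNPP. intro Hn. apply (fu_proper HU).
  revert H. now apply (fu_mono HU).
Qed.

Lemma U_iff (A B : nat -> Prop) : (forall n, A n <-> B n) -> U A <-> U B.
Proof. intro H. split; apply (fu_mono HU); intro n; apply H. Qed.

Definition put (x : I -> nat) (i : I) (d : nat) : I -> nat :=
  fun j => if excluded_middle_informative (j = i) then d else x j.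

Lemma put_swap x i j d e : i <> j -> put (put x i d) j e = put (put x j e) i d.
Proof.
  intro H. extensionality k. unfold put.
  destruct (excluded_middle_informative (k = j)), (excluded_middle_informative (k = i));
    congruence.
Qed.

(* The quantifier [U i1, ..., U ik] over the coordinates listed in [F]. *)
Fixpoint iterq (F : list I) (A : (I -> nat) -> Prop) (x : I -> nat) : Prop :=
  match F with
  | nil => A x
  | i :: F => U (fun d => iterq F A (put x i d))
  end.

Lemma iterq_mono F (A B : (I -> nat) -> Prop) :
  (forall x, A x -> B x) -> forall x, iterq F A x -> iterq F B x.
Proof.
  intro H. induction F as [|i F IH]; simpl; auto.
  intro x. apply (fu_mono HU). auto.
Qed.

Lemma iterq_and F (A B : (I -> nat) -> Prop) : forall x,
  iterq F A x -> iterq F B x -> iterq F (fun x => A x /\ B x) x.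
Proof.
  induction F as [|i F IH]; simpl; auto.
  intros x HA HB. apply (fu_mono HU) with (2 := fu_and HU _ _ HA HB).
  intros n []; auto.
Qed.

Lemma iterq_all F (A : (I -> nat) -> Prop) : (forall x, A x) -> forall x, iterq F A x.
Proof. intro H. induction F as [|i F IH]; simpl; auto. intro x. now apply U_all. Qed.

Lemma iterq_false F x : ~ iterq F (fun _ => False) x.
Proof.
  revert x. induction F as [|i F IH]; simpl; auto.
  intros x H. apply (fu_proper HU). revert H. apply (fu_mono HU). intro n. apply IH.
Qed.

Lemma iterq_ultra F (A : (I -> nat) -> Prop) : forall x,
  iterq F A x \/ iterq F (fun x => ~ A x) x.
Proof.
  induction F as [|i F IH]; simpl; intro x; [apply classic|].
  destruct (fu_ultra HU (fun d => iterq F A (put x i d))) as [H|H]; auto.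
  right. revert H. apply (fu_mono HU). intros n Hn.
  destruct (IH (put x i n)); tauto.
Qed.

Definition ignores (A : (I -> nat) -> Prop) (i : I) : Prop :=
  forall x d, A (put x i d) <-> A x.

Lemma iterq_put F A i d : ~ In i F -> ignores A i ->
  forall x, iterq F A (put x i d) <-> iterq F A x.
Proof.
  intros Hi HA. induction F as [|j F IH]; simpl; intro x; [apply HA|].
  apply U_iff. intro e. rewrite put_swap.
  - apply IH. intro H; apply Hi; now right.
  - intros ->; apply Hi; now left.
Qed.

(** A quantifier over an ignored coordinate is vacuous. The remaining ones occur in the same order
    in both sorted lists, which matters because quantifiers over [U] do not commute. *)
Lemma iterq_weaken A : forall G F,
  StronglySorted lt G -> StronglySorted lt F -> incl F G ->
  (forall i, In i G -> ~ In i F -> ignores A i) ->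
  forall x, iterq F A x <-> iterq G A x.
Proof.
  induction G as [|g G IH]; intros F HG HF Hincl HA x.
  - destruct F as [|i F]; [reflexivity|]. destruct (Hincl i). now left.
  - apply StronglySorted_inv in HG as [HG Hg].
    rewrite Forall_forall in Hg.
    destruct (classic (In g F)) as [Hin|Hin].
    + destruct F as [|f F]; [destruct Hin|].
      apply StronglySorted_inv in HF as [HF Hf].
      rewrite Forall_forall in Hf.
      (* Otherwise [g] lies in the tail of [F] and [f] in the tail of [G], giving both [lt f g] and
         [lt g f]. *)
      assert (f = g) as ->.
      { destruct Hin as [|Hin]; auto.
        destruct (Hincl f (or_introl eq_refl)) as [|Hf']; auto.
        exfalso. eapply lt_irrefl, lt_trans; [apply Hf, Hin|apply Hg, Hf']. }
      simpl. apply U_iff. intro d. apply IH; auto.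
      * intros i Hi. destruct (Hincl i (or_intror Hi)) as [<-|]; auto.
        exfalso. apply (@lt_irrefl g). auto.
      * intros i Hi Hi'. apply HA; [now right|].
        intros [<-|]; auto. apply (@lt_irrefl g). auto.
    (* Here [g] is ignored, so a vacuous quantifier is added on the left to match the one over
       [g]. *)
    + simpl. rewrite <- (U_const (iterq F A x)). apply U_iff. intro d.
      transitivity (iterq F A (put x g d)); [|apply IH; auto].
      * symmetry. apply iterq_put; auto. apply HA; auto. now left.
      * intros i Hi. destruct (Hincl i Hi) as [<-|]; tauto.
      * intros i Hi Hi'. apply HA; auto. now right.
Qed.

Lemma sorted_insert i F : StronglySorted lt F ->
  exists G, StronglySorted lt G /\ forall j, In j G <-> j = i \/ In j F.
Proof.
  induction F as [|f F IH]; intro HF.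
  - exists (i :: nil). split; [repeat constructor|].
    intro j; simpl; intuition.
  - pose proof HF as HF0.
    apply StronglySorted_inv in HF as [HF Hf].
    destruct (lt_total i f) as [Hlt|[<-|Hlt]].
    + exists (i :: f :: F). split.
      * constructor; auto. constructor; auto.
        revert Hf. apply Forall_impl. eauto.
      * intro j; simpl; intuition.
    + exists (i :: F). split; auto. intro j; simpl; intuition.
    + destruct (IH HF) as [G [HG Hin]]. exists (f :: G). split.
      * constructor; auto. rewrite Forall_forall in Hf |- *.
        intros j Hj. apply Hin in Hj as [->|]; auto.
      * intro j; simpl. rewrite Hin. intuition.
Qed.

Lemma sorted_cover l : exists F, StronglySorted lt F /\ incl l F.
Proof.
  induction l as [|i l [F [HF Hl]]].
  - exists nil. split; [constructor|intros i []].
  - destruct (sorted_insert i HF) as [G [HG Hin]]. exists G. split; auto.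
    intros j [<-|Hj]; apply Hin; auto.
Qed.

(** The limit of the iterated quantifiers along the directed set of finite sorted lists. No finite
    support is required of [A], so that monotonicity and intersection need no side conditions. *)
Definition large (A : (I -> nat) -> Prop) : Prop :=
  exists F0, forall F, StronglySorted lt F -> incl F0 F -> iterq F A (fun _ => 0).

Definition agree (F : list I) (x y : I -> nat) : Prop := forall i, In i F -> x i = y i.

Definition supported (F : list I) (A : (I -> nat) -> Prop) : Prop :=
  forall x y, agree F x y -> A x -> A y.

Lemma large_mono (A B : (I -> nat) -> Prop) :
  (forall x, A x -> B x) -> large A -> large B.
Proof.
  intros H [F0 HF0]. exists F0. intros F HF Hi. apply iterq_mono with A; auto.
Qed.

Lemma large_and A B : large A -> large B -> large (fun x => A x /\ B x).
Proof.
  intros [F HA] [G HB]. exists (F ++ G). intros K HK Hi.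
  apply incl_app_inv in Hi as [? ?]. apply iterq_and; auto.
Qed.

Lemma large_all (A : (I -> nat) -> Prop) : (forall x, A x) -> large A.
Proof. intro H. exists nil. intros. now apply iterq_all. Qed.

Lemma large_false : ~ large (fun _ => False).
Proof.
  intros [F0 H]. destruct (sorted_cover F0) as [F [HF Hi]].
  exact (iterq_false _ _ (H F HF Hi)).
Qed.

Lemma supported_ignores F A i : supported F A -> ~ In i F -> ignores A i.
Proof.
  intros HA Hi x d.
  assert (Hp : agree F x (put x i d)).
  { intros j Hj. unfold put. destruct (excluded_middle_informative (j = i)); congruence. }
  split; apply HA; auto. intros j Hj. symmetry. auto.
Qed.

(** By [iterq_weaken], the verdict of a list that contains the support persists to every larger
    list. *)
Lemma large_of_iterq F A : StronglySorted lt F -> supported F A ->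
  iterq F A (fun _ => 0) -> large A.
Proof.
  intros HF HA H. exists F. intros G HG Hi.
  apply (iterq_weaken (A := A)) with (F := F); auto.
  intros i _ Hn. now apply supported_ignores with F.
Qed.

Lemma large_ultra F A : supported F A -> large A \/ large (fun x => ~ A x).
Proof.
  intro HA. destruct (sorted_cover F) as [G [HG Hi]].
  assert (HA' : forall x y, agree G x y -> A x -> A y).
  { intros x y Hxy. apply HA. intros i Hin. auto. }
  destruct (iterq_ultra G A (fun _ => 0)) as [H|H]; [left|right];
    apply large_of_iterq with G; auto.
  intros x y Hxy Hx Hy. apply Hx. revert Hy. apply HA'.
  intros i Hin. symmetry. auto.
Qed.

Lemma large_distinct i j : i <> j -> large (fun x => x i <> x j).
Proof.
  assert (Hlt : forall i j, lt i j -> large (fun x => x i <> x j)).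
  { clear i j. intros i j Hij.
    assert (Hne : i <> j) by (intros ->; now apply lt_irrefl in Hij).
    apply large_of_iterq with (i :: j :: nil).
    - repeat constructor; auto.
    - intros x y Hxy. rewrite (Hxy i), (Hxy j); simpl; auto.
    (* Once [x i] has the value [d], almost every value of the later coordinate [x j] exceeds [d],
       since [U] is free. *)
    - simpl. apply U_all. intro d. apply (fu_mono HU) with (2 := fu_free HU d).
      intros e Hde. unfold put.
      destruct (excluded_middle_informative (i = j)); [tauto|].
      destruct (excluded_middle_informative (i = i)); [|tauto].
      destruct (excluded_middle_informative (j = j)); [lia|tauto]. }
  intro H. destruct (lt_total i j) as [Hij|[?|Hij]]; [auto|tauto|].
  apply large_mono with (2 := Hlt _ _ Hij). auto.
Qed.

(** * Invariance under automorphisms of the index order *)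

Record order_aut (sg tau : I -> I) : Prop := {
  oa_left : forall i, tau (sg i) = i;
  oa_right : forall i, sg (tau i) = i;
  oa_mono : forall i j, lt i j -> lt (sg i) (sg j);
  oa_inv_mono : forall i j, lt i j -> lt (tau i) (tau j) }.

Lemma order_aut_sym sg tau : order_aut sg tau -> order_aut tau sg.
Proof. intros []. constructor; auto. Qed.

Lemma iterq_perm sg tau A : order_aut sg tau -> forall F x,
  iterq F (fun x => A (fun i => x (sg i))) x <->
  iterq (map tau F) A (fun i => x (sg i)).
Proof.
  intros Hs F. induction F as [|i F IH]; simpl; intro x; [reflexivity|].
  apply U_iff. intro d. rewrite IH.
  replace (fun j => put x i d (sg j)) with (put (fun j => x (sg j)) (tau i) d);
    [reflexivity|].
  extensionality j. unfold put.
  destruct (excluded_middle_informative (j = tau i)) as [E|E],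
    (excluded_middle_informative (sg j = i)) as [E'|E']; auto.
  - destruct E'. rewrite E. apply (oa_right Hs).
  - destruct E. rewrite <- E'. symmetry. apply (oa_left Hs).
Qed.

(** Reindexing turns quantification along [F] into quantification along [map tau F], and this list
    is again sorted because [tau] preserves the order. *)
Lemma large_perm sg tau A : order_aut sg tau ->
  large A -> large (fun x => A (fun i => x (sg i))).
Proof.
  intros Hs [F0 HF0]. exists (map sg F0). intros F HF Hi.
  apply (iterq_perm A Hs). apply HF0.
  - clear Hi. induction HF as [|i F HF IH Hi]; simpl; constructor; auto.
    rewrite Forall_map. revert Hi. apply Forall_impl. apply (oa_inv_mono Hs).
  - intros i Hin. rewrite <- (oa_left Hs i). apply in_map, Hi, in_map, Hin.
Qed.

End IteratedUltrafilter.

(** * The limit structure *)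

Section LimitStructure.
Variables (U : (nat -> Prop) -> Prop) (HU : free_ultrafilter U).
Variables (I : Type) (lt : I -> I -> Prop).
Hypothesis lt_irrefl : forall i, ~ lt i i.
Hypothesis lt_trans : forall i j k, lt i j -> lt j k -> lt i k.
Hypothesis lt_total : forall i j, lt i j \/ i = j \/ lt j i.
Variables (s : signature) (M : nat -> structure s).

(** The index [n] is quantified outermost, so the list witnessing largeness may depend on [n]. *)
Definition ae (A : nat -> (I -> nat) -> Prop) : Prop := U (fun n => large U lt (A n)).

Lemma ae_mono (A B : nat -> (I -> nat) -> Prop) :
  (forall n x, A n x -> B n x) -> ae A -> ae B.
Proof.
  intro H. apply (fu_mono HU). intro n. apply (large_mono HU). auto.
Qed.

Lemma ae_and (A B : nat -> (I -> nat) -> Prop) :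
  ae A -> ae B -> ae (fun n x => A n x /\ B n x).
Proof.
  intros HA HB. apply (fu_mono HU) with (2 := fu_and HU _ _ HA HB).
  intros n []. now apply (large_and HU).
Qed.

Lemma ae_mono2 (A B C : nat -> (I -> nat) -> Prop) :
  (forall n x, A n x -> B n x -> C n x) -> ae A -> ae B -> ae C.
Proof.
  intros H HA HB. apply ae_mono with (2 := ae_and HA HB).
  intros n x []. auto.
Qed.

Lemma ae_all (A : nat -> (I -> nat) -> Prop) : (forall n x, A n x) -> ae A.
Proof. intro H. apply (U_all HU). intro n. apply (large_all HU). auto. Qed.

Lemma ae_false : ~ ae (fun _ _ => False).
Proof.
  intro H. apply (fu_proper HU). revert H. apply (fu_mono HU).
  intro n. apply large_false; auto.
Qed.

Lemma ae_ultra F (A : nat -> (I -> nat) -> Prop) :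
  (forall n, supported F (A n)) -> ae A \/ ae (fun n x => ~ A n x).
Proof.
  intro HA. destruct (fu_ultra HU (fun n => large U lt (A n))) as [H|H]; auto.
  right. revert H. apply (fu_mono HU). intros n Hn.
  destruct (large_ultra HU lt lt_irrefl lt_trans lt_total (HA n)); tauto.
Qed.

Lemma ae_Fin k (A : Fin.t k -> nat -> (I -> nat) -> Prop) :
  (forall i, ae (A i)) -> ae (fun n x => forall i, A i n x).
Proof.
  intro H. destruct (Fin_list k) as [l Hl].
  assert (Hi : ae (fun n x => forall i, In i l -> A i n x)).
  { clear Hl. induction l as [|i l IH].
    - apply ae_all. intros n x i [].
    - apply ae_mono2 with (2 := H i) (3 := IH).
      intros n x Hi Hj j [<-|Hjl]; auto. }
  revert Hi. apply ae_mono. auto.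
Qed.

Lemma ae_perm sg tau (A : nat -> (I -> nat) -> Prop) : order_aut lt sg tau ->
  ae A -> ae (fun n x => A n (fun i => x (sg i))).
Proof. intro Hs. apply (fu_mono HU). intro n. now apply (large_perm HU) with tau. Qed.

(** * Families of finite support modulo almost everywhere equality *)

Definition family : Type := forall n, (I -> nat) -> dom (M n).

Definition fsupp (F : list I) (f : family) : Prop :=
  forall n x y, agree F x y -> f n x = f n y.

Definition admissible (f : family) : Prop := exists F, fsupp F f.

Definition eqv (f g : family) : Prop := ae (fun n x => f n x = g n x).

Lemma eqv_refl f : eqv f f.
Proof. apply ae_all. auto. Qed.

Lemma eqv_sym f g : eqv f g -> eqv g f.
Proof. apply ae_mono. auto. Qed.

Lemma eqv_trans f g h : eqv f g -> eqv g h -> eqv f h.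
Proof. apply ae_mono2. congruence. Qed.

Lemma fsupp_incl F G f : incl F G -> fsupp F f -> fsupp G f.
Proof. intros Hi HF n x y Hxy. apply HF. intros i Hin. auto. Qed.

Lemma common_fsupp A (f : A -> family) (l : list A) :
  (forall a, admissible (f a)) -> exists F, forall a, In a l -> fsupp F (f a).
Proof.
  intro H. induction l as [|a l [F HF]].
  - exists nil. intros a [].
  - destruct (H a) as [G HG]. exists (G ++ F). intros b [<-|Hb].
    + apply fsupp_incl with (2 := HG). apply incl_appl, incl_refl.
    + apply fsupp_incl with (2 := HF b Hb). apply incl_appr, incl_refl.
Qed.

(* The quotient of the admissible families by [eqv] is realised by a system of
   representatives. *)
Definition canon (f : family) : family :=
  epsilon (inhabits f) (fun g => admissible g /\ eqv f g).

Lemma canon_spec f : admissible f -> admissible (canon f) /\ eqv f (canon f).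
Proof. intro Hf. unfold canon. apply epsilon_spec. exists f. auto using eqv_refl. Qed.

Lemma canon_eq f g : eqv f g -> canon f = canon g.
Proof.
  (* Equivalent families define the same predicate, and the two inhabitation proofs are equal, so
     [epsilon] makes the same choice. *)
  intro H. unfold canon. rewrite (proof_irrelevance _ (inhabits f) (inhabits g)).
  f_equal. extensionality h. apply propositional_extensionality.
  split; intros [Ha Hh]; split; auto; eapply eqv_trans; eauto using eqv_sym.
Qed.

Definition point : Type := {f : family | admissible f /\ canon f = f}.

Definition val (c : point) : family := proj1_sig c.

Lemma val_admissible c : admissible (val c).
Proof. apply (proj2_sig c). Qed.

Lemma val_ext c d : eqv (val c) (val d) -> c = d.
Proof.
  intro H. apply canon_eq in H. unfold val in H.
  destruct c as [f [Hf Ef]], d as [g [Hg Eg]]; simpl in H.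
  apply subset_eq_compat. congruence.
Qed.

Definition mk (f : family) (Hf : admissible f) : point :=
  exist _ (canon f)
    (conj (proj1 (canon_spec Hf)) (eq_sym (canon_eq (proj2 (canon_spec Hf))))).

Lemma val_mk f (Hf : admissible f) : eqv (val (mk Hf)) f.
Proof. apply eqv_sym, canon_spec, Hf. Qed.

Lemma fint_admissible (f : funs s) (a : Fin.t (fun_ar s f) -> point) :
  admissible (fun n x => fint (M n) f (fun i => val (a i) n x)).
Proof.
  destruct (Fin_list (fun_ar s f)) as [l Hl].
  destruct (common_fsupp (fun i => val (a i)) l) as [F HF].
  - intro i. apply val_admissible.
  - exists F. intros n x y Hxy. f_equal. extensionality i. now apply HF.
Qed.

Lemma point_inhabited : inhabited point.
Proof.
  refine (inhabits (@mk (fun n _ => epsilon (dom_inh (M n)) (fun _ => True)) _)).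
  exists nil. intros n x y _. reflexivity.
Qed.

Definition limit : structure s := {|
  dom := point;
  dom_inh := point_inhabited;
  fint := fun f a => mk (fint_admissible f a);
  rint := fun r a => ae (fun n x => rint (M n) r (fun i => val (a i) n x)) |}.

Lemma eval_limit (rho : nat -> dom limit) (t : term s) :
  ae (fun n x => val (eval limit rho t) n x = eval (M n) (fun k => val (rho k) n x) t).
Proof.
  induction t as [k|f a IH]; simpl.
  - apply ae_all. auto.
  - apply ae_mono2 with (2 := val_mk (fint_admissible f (fun i => eval limit rho (a i))))
      (3 := ae_Fin _ IH).
    intros n x E H. etransitivity; [exact E|]. f_equal. extensionality i. apply H.
Qed.

Lemma upd_val (rho : nat -> dom limit) y (d : dom limit) n x :
  (fun k => val (upd limit rho y d k) n x) =
  upd (M n) (fun k => val (rho k) n x) y (val d n x).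
Proof. extensionality k. unfold upd. now destruct (Nat.eqb k y). Qed.

Lemma csat_supported (rho : nat -> dom limit) p : exists F, forall n x y,
  agree F x y ->
  csat (M n) (fun k => val (rho k) n x) p -> csat (M n) (fun k => val (rho k) n y) p.
Proof.
  destruct (csat_bound p) as [b Hb].
  destruct (common_fsupp (fun k => val (rho k)) (seq 0 b)) as [F HF].
  - intro k. apply val_admissible.
  - exists F. intros n x y Hxy. apply Hb. intros k Hk.
    apply HF; auto. apply in_seq. lia.
Qed.

(** A choice made from [restr F x] instead of [x] depends on the coordinates in [F] alone. *)
Definition restr (F : list I) (x : I -> nat) : I -> nat :=
  fun i => if excluded_middle_informative (In i F) then x i else 0.

Lemma restr_agree F x : agree F x (restr F x).
Proof.
  intros i Hi. unfold restr. now destruct (excluded_middle_informative (In i F)).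
Qed.

Lemma restr_eq F x y : agree F x y -> restr F x = restr F y.
Proof.
  intro H. extensionality i. unfold restr.
  destruct (excluded_middle_informative (In i F)); auto.
Qed.

(* Existential witnesses are chosen as functions of the finitely many coordinates
   on which the parameters depend, so no Skolem functions are required. *)
Lemma witness_admissible (rho : nat -> dom limit) y p :
  exists g, admissible g /\ forall n x,
    (exists d, csat (M n) (upd (M n) (fun k => val (rho k) n x) y d) p) ->
    csat (M n) (upd (M n) (fun k => val (rho k) n x) y (g n x)) p.
Proof.
  destruct (csat_bound p) as [b Hb].
  destruct (common_fsupp (fun k => val (rho k)) (seq 0 b)) as [F HF].
  { intro k. apply val_admissible. }
  exists (fun n x => epsilon (dom_inh (M n)) (fun d =>
    csat (M n) (upd (M n) (fun k => val (rho k) n (restr F x)) y d) p)).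
  split.
  - exists F. intros n x z Hxz. now rewrite (restr_eq Hxz).
  - intros n x [d Hd].
    assert (E : forall k e, k < b ->
      upd (M n) (fun k => val (rho k) n x) y e k =
      upd (M n) (fun k => val (rho k) n (restr F x)) y e k).
    { intros k e Hk. unfold upd. destruct (Nat.eqb k y); auto.
      apply HF; [apply in_seq; lia|]. apply restr_agree. }
    eapply Hb; [intros k Hk; symmetry; now apply E|].
    apply epsilon_spec. exists d. revert Hd. apply Hb. intros k Hk. now apply E.
Qed.

(** Negation rests on [ae_ultra], which applies because the truth of a formula depends on finitely
    many coordinates; the existential case rests on an admissible choice of witnesses. *)
Theorem Los p : forall rho : nat -> dom limit,
  csat limit rho p <-> ae (fun n x => csat (M n) (fun k => val (rho k) n x) p).
Proof.
  induction p as [|t1 t2|r a|q IH|q1 IH1 q2 IH2|y q IH]; simpl; intro rho.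
  - split; [tauto|apply ae_false].
  - pose proof (eval_limit rho t1) as H1. pose proof (eval_limit rho t2) as H2.
    split.
    + intro E. rewrite E in H1. revert H1 H2. apply ae_mono2. congruence.
    + intro E. apply val_ext. unfold eqv.
      apply ae_mono2 with (2 := E) (3 := ae_and H1 H2). intros n x Ex []. congruence.
  - pose proof (ae_Fin _ (fun i => eval_limit rho (a i))) as H.
    split; apply ae_mono2 with (2 := H); intros n x E; simpl in E;
      replace (fun i => eval (M n) (fun k => val (rho k) n x) (a i))
      with (fun i => val (eval limit rho (a i)) n x); auto; extensionality i; apply E.
  - rewrite IH. destruct (csat_supported rho q) as [F HF]. split.
    + intro H. destruct (ae_ultra (F := F)
        (fun n x => csat (M n) (fun k => val (rho k) n x) q)); [|tauto|assumption].
      intros n x y. apply HF.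
    + intros H H'. apply ae_false. revert H H'. apply ae_mono2. auto.
  - rewrite IH1, IH2. split.
    + intros []. now apply ae_and.
    + intro H. split; revert H; apply ae_mono; tauto.
  - split.
    + intros [d Hd]. apply IH in Hd. revert Hd. apply ae_mono.
      intros n x. rewrite upd_val. now exists (val d n x).
    + intro H. destruct (witness_admissible rho y q) as [g [Hg Hw]].
      exists (mk Hg). apply IH.
      apply ae_mono2 with (2 := H) (3 := val_mk Hg).
      intros n x Hd E. rewrite upd_val, E. auto.
Qed.

(** * Automorphisms of the limit *)

Lemma shift_admissible sg (c : point) :
  admissible (fun n x => val c n (fun i : I => x (sg i))).
Proof.
  destruct (val_admissible c) as [F HF]. exists (map sg F).
  intros n x y Hxy. apply HF. intros i Hi. apply Hxy, in_map, Hi.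
Qed.

Definition induced (sg : I -> I) (c : dom limit) : dom limit := mk (shift_admissible sg c).

(** [induced] passes to a representative, so [val (induced sg c)] is known only almost everywhere;
    [ae_perm] carries this knowledge through the second reindexing. *)
Lemma induced_inv sg tau c : order_aut lt sg tau -> induced tau (induced sg c) = c.
Proof.
  intro Hs. apply val_ext. eapply eqv_trans; [apply val_mk|].
  pose proof (ae_perm (order_aut_sym Hs) (val_mk (shift_admissible sg c))) as H.
  simpl in H. revert H. apply ae_mono. intros n x E.
  unfold induced. etransitivity; [exact E|]. f_equal.
  extensionality i. f_equal. apply Hs.
Qed.

Lemma rint_induced sg tau r a : order_aut lt sg tau ->
  rint limit r a -> rint limit r (fun i => induced sg (a i)).
Proof.
  intros Hs H. simpl in *. apply (ae_perm Hs) in H. simpl in H.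
  apply ae_mono2 with (2 := H)
    (3 := ae_Fin _ (fun i => val_mk (shift_admissible sg (a i)))).
  intros n x Hr E. simpl in E.
  assert (E' : (fun i => val (induced sg (a i)) n x) =
    (fun i => val (a i) n (fun j => x (sg j)))) by (extensionality i; apply E).
  exact (eq_ind_r (rint (M n) r) Hr E').
Qed.

Lemma induced_aut sg tau : order_aut lt sg tau -> is_aut limit (induced sg).
Proof.
  intro Hs. split; [|split].
  - exists (induced tau). intro c. split.
    + now apply induced_inv.
    + apply induced_inv. now apply order_aut_sym.
  - intros f a. apply val_ext. eapply eqv_trans; [apply val_mk|].
    apply eqv_sym. eapply eqv_trans; [apply val_mk|]. apply eqv_sym.
    pose proof (ae_perm Hs (val_mk (fint_admissible f a))) as H. simpl in H.
    apply ae_mono2 with (2 := H)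
      (3 := ae_Fin _ (fun i => val_mk (shift_admissible sg (a i)))).
    intros n x E Ea. simpl in Ea. etransitivity; [exact E|]. f_equal.
    extensionality i. symmetry. apply Ea.
  - intros r a. split; [now apply rint_induced with tau|].
    intro H. apply (rint_induced (order_aut_sym Hs)) in H.
    replace a with (fun i => induced tau (induced sg (a i))); auto.
    extensionality i. now apply induced_inv.
Qed.

(** The separating point is the coordinate [x i] read through [e]: [sg] moves it to the coordinate
    [x (sg i)], and different coordinates differ almost everywhere. *)
Lemma induced_separates (e : forall n, nat -> dom (M n)) :
  (forall n a b, e n a = e n b -> a = b) ->
  forall i, exists c : dom limit, forall sg tau sg' tau',
    order_aut lt sg tau -> order_aut lt sg' tau' ->
    induced sg c = induced sg' c -> sg i = sg' i.
Proof.
  intros He i.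
  assert (Ha : admissible (fun n x => e n (x i))).
  { exists (i :: nil). intros n x y Hxy. f_equal. apply Hxy. now left. }
  exists (mk Ha). intros sg tau sg' tau' Hs Hs' E. apply NNPP. intro Hne.
  assert (H : forall sg tau, order_aut lt sg tau ->
    ae (fun n x => val (induced sg (mk Ha)) n x = e n (x (sg i)))).
  { clear sg tau sg' tau' Hs Hs' E Hne. intros sg tau Hs. eapply eqv_trans; [apply val_mk|].
    exact (ae_perm Hs (val_mk Ha)). }
  apply ae_false.
  assert (Hd : ae (fun _ x => x (sg i) <> x (sg' i))).
  { apply (U_all HU). intros _. now apply large_distinct. }
  apply ae_mono2 with (2 := ae_and (H _ _ Hs) (H _ _ Hs')) (3 := Hd).
  intros n x [E1 E2] Hx. apply Hx, (He n). rewrite E in E1. congruence.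
Qed.

End LimitStructure.

(** * An order with many automorphisms *)

Lemma least_nat (P : nat -> Prop) :
  (exists n, P n) -> exists n, P n /\ forall m, m < n -> ~ P m.
Proof.
  intros [n Hn]. revert Hn. induction n as [n IH] using lt_wf_ind. intro Hn.
  destruct (classic (exists m, m < n /\ P m)) as [[m [Hmn Hm]]|H]; eauto.
  exists n. split; auto. intros m Hmn Hm. apply H. eauto.
Qed.

(** An explicit linear order on a set of size continuum, along which the copies of [Z] are
    arranged. *)
Definition lex (a b : nat -> bool) : Prop :=
  exists n, (forall m, m < n -> a m = b m) /\ a n = false /\ b n = true.

Lemma lex_irrefl a : ~ lex a a.
Proof. intros [n [_ [H1 H2]]]. congruence. Qed.

Lemma lex_trans a b c : lex a b -> lex b c -> lex a c.
Proof.
  intros [n [Hn [Ha Hb]]] [k [Hk [Hb' Hc]]].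
  destruct (lt_eq_lt_dec n k) as [[H|<-]|H].
  - exists n. split; [|split; [auto|now rewrite <- Hk]].
    intros m Hm. rewrite Hn, Hk; auto; lia.
  - congruence.
  - exists k. split; [|split; [now rewrite Hn|auto]].
    intros m Hm. rewrite Hn, Hk; auto; lia.
Qed.

Lemma lex_total a b : lex a b \/ a = b \/ lex b a.
Proof.
  destruct (classic (exists n, a n <> b n)) as [H|H].
  - destruct (least_nat _ H) as [n [Hn Hl]].
    assert (Heq : forall m, m < n -> a m = b m) by (intros m Hm; apply NNPP; auto).
    destruct (a n) eqn:Ha, (b n) eqn:Hb; try congruence.
    + right; right. exists n. split; auto. intros m Hm. symmetry. auto.
    + left. exists n. auto.
  - right; left. extensionality n. apply NNPP. eauto.
Qed.

(* The copies of [Z] can be shifted independently of each other. *)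
Definition index : Type := ((nat -> bool) * Z)%type.

Definition index_lt (i j : index) : Prop :=
  lex (fst i) (fst j) \/ fst i = fst j /\ (snd i < snd j)%Z.

Lemma index_lt_irrefl i : ~ index_lt i i.
Proof. intros [H|[_ H]]; [now apply lex_irrefl in H|lia]. Qed.

Lemma index_lt_trans i j k : index_lt i j -> index_lt j k -> index_lt i k.
Proof.
  unfold index_lt. intros [H|[E H]] [H'|[E' H']].
  - left. eapply lex_trans; eauto.
  - left. congruence.
  - left. congruence.
  - right. split; [congruence|lia].
Qed.

Lemma index_lt_total i j : index_lt i j \/ i = j \/ index_lt j i.
Proof.
  destruct i as [a z], j as [b w]. unfold index_lt; simpl.
  destruct (lex_total a b) as [H|[->|H]]; auto.
  destruct (Z.lt_trichotomy z w) as [H|[->|H]]; auto.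
Qed.

(** Each set [S] of copies gives its own automorphism, translating by one exactly the copies in [S];
    hence there are as many as subsets of the continuum. *)
Definition shift (S : (nat -> bool) -> bool) (i : index) : index :=
  (fst i, if S (fst i) then Z.succ (snd i) else snd i).

Definition unshift (S : (nat -> bool) -> bool) (i : index) : index :=
  (fst i, if S (fst i) then Z.pred (snd i) else snd i).

Lemma shift_order_aut S : order_aut index_lt (shift S) (unshift S).
Proof.
  constructor; unfold shift, unshift, index_lt; simpl.
  - intros [a z]; simpl. f_equal. destruct (S a); lia.
  - intros [a z]; simpl. f_equal. destruct (S a); lia.
  - intros [a z] [b w]; simpl. intros [H|[-> H]]; auto.
    right. split; auto. destruct (S b); lia.
  - intros [a z] [b w]; simpl. intros [H|[-> H]]; auto.
    right. split; auto. destruct (S b); lia.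
Qed.

(** Cantor's diagonal argument: [D] consists of the codes [k S] that do not belong to [S], and the
    contradiction arises at [k D]. *)
Lemma no_injection_into_continuum (k : ((nat -> bool) -> bool) -> nat -> bool) :
  ~ (forall S S', k S = k S' -> S = S').
Proof.
  intro Hk.
  set (D := fun b => if excluded_middle_informative (exists S, k S = b /\ S b = false)
                     then true else false).
  assert (HD : D (k D) = true <-> exists S, k S = k D /\ S (k D) = false).
  { unfold D at 1.
    destruct (excluded_middle_informative (exists S, k S = k D /\ S (k D) = false));
      split; congruence || tauto. }
  destruct (D (k D)) eqn:E.
  - destruct (proj1 HD eq_refl) as [S [ES HS]]. apply Hk in ES. congruence.
  - enough (false = true) by discriminate. apply HD. now exists D.
Qed.

(** * Size of the automorphism group *)

Definition infinite (A : Type) : Prop :=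
  exists e : nat -> A, forall a b, e a = e b -> a = b.

Theorem limit_exists s (M : nat -> structure s) : exists N : structure s,
  (forall p, (exists m, forall n, m < n -> forall rho, csat (M n) rho p) ->
     forall rho, csat N rho p) /\
  ((forall n, infinite (dom (M n))) -> ~ aut_le_continuum N).
Proof.
  destruct free_ultrafilter_exists as [U HU].
  exists (limit HU index_lt M).
  split.
  - intros p [m Hm] rho. apply (Los index_lt_irrefl index_lt_trans index_lt_total).
    apply (fu_mono HU) with (2 := fu_free HU m). intros n Hn.
    apply (large_all HU). auto.
  - intros He [h Hh].
    set (e := fun n => proj1_sig (constructive_indefinite_description _ (He n))).
    assert (Hinj : forall n a b, e n a = e n b -> a = b).
    { intro n. exact (proj2_sig (constructive_indefinite_description _ (He n))). }
    apply (no_injection_into_continuum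
      (fun S => h (induced (shift S)))).
    intros S S' E. extensionality a.
    (* The origin of copy [a] is moved by [shift S] exactly when [S a] is true, so its image
       recovers [S a]. *)
    destruct (induced_separates HU index_lt index_lt_irrefl index_lt_trans index_lt_total
      M e Hinj (a, 0%Z)) as [c Hc].
    assert (Hi : shift S (a, 0%Z) = shift S' (a, 0%Z)).
    { eapply Hc; [apply shift_order_aut|apply shift_order_aut|].
      apply Hh; [eapply induced_aut, shift_order_aut|eapply induced_aut, shift_order_aut|].
      intro n. exact (f_equal (fun f => f n) E). }
    unfold shift in Hi; simpl in Hi. injection Hi.
    destruct (S a), (S' a); auto; discriminate.
Qed.

(** [R n a] makes [n] a name of [a]. A map is determined by its graph, coded as a set of pairs of
    names. As a relation, [R] leaves some numbers without meaning, so finite domains are covered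
    too. *)
Lemma countable_aut s (M : structure s) (R : nat -> dom M -> Prop) :
  (forall n a b, R n a -> R n b -> a = b) -> (forall a, exists n, R n a) ->
  aut_le_continuum M.
Proof.
  intros Hf Ht.
  set (Q := fun (g : dom M -> dom M) n => exists a b,
    R (fst (of_nat n)) a /\ R (snd (of_nat n)) b /\ g a = b).
  exists (fun g n => if excluded_middle_informative (Q g n) then true else false).
  intros g1 g2 _ _ H a.
  destruct (Ht a) as [n Hn], (Ht (g1 a)) as [m Hm]. specialize (H (to_nat (n, m))).
  (* The pair of names of [a] and [g1 a] is in the graph of [g1], hence in that of [g2]. *)
  assert (H1 : Q g1 (to_nat (n, m))).
  { exists a, (g1 a). rewrite cancel_of_to. auto. }
  destruct (excluded_middle_informative (Q g1 (to_nat (n, m)))); [|tauto].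
  destruct (excluded_middle_informative (Q g2 (to_nat (n, m)))) as [H2|]; [|discriminate].
  destruct H2 as [a' [b [Ha [Hb E]]]]. rewrite cancel_of_to in Ha, Hb; simpl in Ha, Hb.
  rewrite (Hf _ _ _ Hn Ha), E, <- (Hf _ _ _ Hn Ha). eauto.
Qed.

(** Greedy construction: the next element is chosen outside the list of all earlier ones. *)
Lemma infinite_of_uncovered (A : Type) :
  (forall l : list A, exists a, ~ In a l) -> infinite A.
Proof.
  intro H.
  set (next := fun l => proj1_sig (constructive_indefinite_description _ (H l))).
  assert (Hnext : forall l, ~ In (next l) l).
  { intro l. exact (proj2_sig (constructive_indefinite_description _ (H l))). }
  set (prefix := fix prefix n := match n with
    | 0 => nil | S n => next (prefix n) :: prefix n end).
  assert (Hin : forall n m, n < m -> In (next (prefix n)) (prefix m)).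
  { intros n m. induction m as [|m IH]; [lia|]. intro Hnm.
    destruct (Nat.eq_dec n m) as [->|]; simpl; auto. right. apply IH. lia. }
  exists (fun n => next (prefix n)). intros n m E.
  destruct (lt_eq_lt_dec n m) as [[Hlt|]|Hlt]; auto; exfalso;
    apply Hin in Hlt.
  - rewrite E in Hlt. now apply Hnext in Hlt.
  - rewrite <- E in Hlt. now apply Hnext in Hlt.
Qed.

(** A list covering the domain would name each element by a position, contradicting
    [countable_aut]. *)
Lemma infinite_of_many_aut s (M : structure s) : ~ aut_le_continuum M -> infinite (dom M).
Proof.
  intro H. apply infinite_of_uncovered. intro l. apply NNPP. intro Hn.
  apply H. apply countable_aut with (R := fun n a => nth_error l n = Some a).
  - congruence.
  - intro a. apply In_nth_error. apply NNPP. eauto.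
Qed.

(** * Countable elementary substructures *)

Definition pr (a b : nat) : nat := to_nat (a, b).

Lemma pr_inj a b c d : pr a b = pr c d -> a = c /\ b = d.
Proof. unfold pr. intro H. apply to_nat_inj in H. injection H. auto. Qed.

Fixpoint vcode (k : nat) : (Fin.t k -> nat) -> nat :=
  match k with
  | 0 => fun _ => 0
  | S k => fun a => pr (a Fin.F1) (vcode (fun i => a (Fin.FS i)))
  end.

Lemma vcode_inj k (a b : Fin.t k -> nat) : vcode a = vcode b -> forall i, a i = b i.
Proof.
  induction k as [|k IH]; simpl; intros H i.
  - exact (Fin.case0 (fun i => a i = b i) i).
  - apply pr_inj in H as [H0 H]. apply (Fin.caseS' i); auto.
    intro j. exact (IH _ _ H j).
Qed.

Section Hull.
Variables (s : signature) (ef : funs s -> nat) (er : rels s -> nat).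
Hypothesis ef_inj : forall f g, ef f = ef g -> f = g.
Hypothesis er_inj : forall r q, er r = er q -> r = q.

Fixpoint tcode (t : term s) : nat :=
  match t with
  | tvar x => pr 0 x
  | tfun f a => pr 1 (pr (ef f) (vcode (fun i => tcode (a i))))
  end.

Lemma tcode_inj t : forall t', tcode t = tcode t' -> t = t'.
Proof.
  induction t as [x|f a IH]; intros [y|g b] H; apply pr_inj in H as [H0 H];
    try discriminate.
  - congruence.
  - apply pr_inj in H as [Hf H]. apply ef_inj in Hf as <-.
    f_equal. extensionality i. apply IH. exact (vcode_inj _ _ H i).
Qed.

Fixpoint ccode (p : cform s) : nat :=
  match p with
  | cFalse => pr 0 0
  | cEq t1 t2 => pr 1 (pr (tcode t1) (tcode t2))
  | cRel r a => pr 2 (pr (er r) (vcode (fun i => tcode (a i))))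
  | cNot q => pr 3 (ccode q)
  | cAnd q1 q2 => pr 4 (pr (ccode q1) (ccode q2))
  | cEx x q => pr 5 (pr x (ccode q))
  end.

Lemma ccode_inj p : forall p', ccode p = ccode p' -> p = p'.
Proof.
  induction p as [|t1 t2|r a|q IH|q1 IH1 q2 IH2|x q IH];
    intros [|t1' t2'|r' a'|q'|q1' q2'|x' q'] H; apply pr_inj in H as [H0 H];
    try discriminate; auto.
  - apply pr_inj in H as [H1 H2]. f_equal; now apply tcode_inj.
  - apply pr_inj in H as [Hr H]. apply er_inj in Hr as <-.
    f_equal. extensionality i. apply tcode_inj. exact (vcode_inj _ _ H i).
  - f_equal. auto.
  - apply pr_inj in H as [H1 H2]. f_equal; auto.
  - apply pr_inj in H as [H1 H2]. f_equal; auto.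
Qed.

(* [nwit p x l] names a witness of [cEx x p] in the environment named by the list [l]. *)
Inductive name : Type :=
| nnil : name
| ncons : name -> name -> name
| nwit : cform s -> nat -> name -> name.

Fixpoint ncode (w : name) : nat :=
  match w with
  | nnil => pr 0 0
  | ncons v l => pr 1 (pr (ncode v) (ncode l))
  | nwit p x l => pr 2 (pr (ccode p) (pr x (ncode l)))
  end.

Lemma ncode_inj w : forall w', ncode w = ncode w' -> w = w'.
Proof.
  induction w as [|v IHv l IHl|p x l IH]; intros [|v' l'|p' x' l'] H;
    apply pr_inj in H as [H0 H]; try discriminate; auto.
  - apply pr_inj in H as [H1 H2]. f_equal; auto.
  - apply pr_inj in H as [H1 H]. apply pr_inj in H as [H2 H].
    f_equal; auto using ccode_inj.
Qed.

Variable M : structure s.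

Definition base : dom M := epsilon (dom_inh M) (fun _ => True).

Definition scons (d : dom M) (rho : nat -> dom M) (i : nat) : dom M :=
  match i with 0 => d | S i => rho i end.

(** Each name is read both as an element and as an environment, which avoids a mutual induction;
    [base] fills the component without meaning and the environment beyond the end of a list. *)
Fixpoint interp (w : name) : dom M * (nat -> dom M) :=
  match w with
  | nnil => (base, fun _ => base)
  | ncons v l => (base, scons (fst (interp v)) (snd (interp l)))
  | nwit p x l =>
      (epsilon (dom_inh M) (fun d => csat M (upd M (snd (interp l)) x d) p),
       fun _ => base)
  end.

Definition in_hull (d : dom M) : Prop := exists w, fst (interp w) = d.

Lemma hull_list b : forall rho : nat -> dom M, (forall k, in_hull (rho k)) ->
  exists l, forall k, k < b -> snd (interp l) k = rho k.
Proof.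
  induction b as [|b IH]; intros rho H.
  - exists nnil. lia.
  - destruct (IH (fun k => rho (S k))) as [l Hl]; auto.
    destruct (H 0) as [v Hv]. exists (ncons v l).
    intros [|k] Hk; simpl; auto. apply Hl. lia.
Qed.

(** The Tarski-Vaught condition. A name holds only a finite part of [rho], which is enough because
    [p] sees only variables below a bound. *)
Lemma hull_witness rho x p d : (forall k, in_hull (rho k)) ->
  csat M (upd M rho x d) p -> exists e, in_hull e /\ csat M (upd M rho x e) p.
Proof.
  intros Hr Hd. destruct (csat_bound p) as [b Hb].
  destruct (hull_list b rho Hr) as [l Hl].
  assert (E : forall e k, k < b -> upd M (snd (interp l)) x e k = upd M rho x e k).
  { intros e k Hk. unfold upd. destruct (Nat.eqb k x); auto. }
  exists (fst (interp (nwit p x l))). split; [now exists (nwit p x l)|].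
  simpl. eapply Hb; [apply E|]. apply epsilon_spec. exists d.
  revert Hd. apply Hb. intros k Hk. symmetry. auto.
Qed.

(** Closure under [f] is the Tarski-Vaught condition for the equation between a fresh variable and
    [f] applied to variables: its only witness is the value of [f]. *)
Lemma hull_fint f a : (forall i, in_hull (a i)) -> in_hull (fint M f a).
Proof.
  intro Ha.
  set (pos := fun i => proj1_sig (@Fin.to_nat (fun_ar s f) i)).
  (* Argument [i] is stored at variable number [i]; all other variables receive some point of the
     hull. *)
  set (rho := fun m => epsilon (inhabits base)
    (fun d => in_hull d /\ forall i, pos i = m -> a i = d)).
  assert (Hrho : forall m, in_hull (rho m) /\ forall i, pos i = m -> a i = rho m).
  { intro m. apply epsilon_spec.
    destruct (classic (exists i, pos i = m)) as [[i <-]|H].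
    - exists (a i). split; auto. intros j Hj. f_equal. now apply Fin.to_nat_inj.
    - exists base. split; [now exists nnil|]. intros i Hi. destruct H. eauto. }
  (* The arity is a fresh variable, as the argument positions lie below it. *)
  set (k := fun_ar s f).
  destruct (@hull_witness rho k (cEq (tvar k) (tfun f (fun i => tvar (pos i))))
    (fint M f a)) as [e [He E]].
  - intro m. apply Hrho.
  - simpl. unfold upd at 1. rewrite Nat.eqb_refl. f_equal. extensionality i.
    unfold upd. replace (Nat.eqb (pos i) k) with false.
    + now apply Hrho.
    + symmetry. apply Nat.eqb_neq. pose proof (proj2_sig (Fin.to_nat i)).
      subst k pos. simpl in *. lia.
  - simpl in E. unfold upd at 1 in E. rewrite Nat.eqb_refl in E.
    replace (fint M f a) with e; auto. rewrite E. f_equal. extensionality i.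
    unfold upd. replace (Nat.eqb (pos i) k) with false.
    + symmetry. now apply Hrho.
    + symmetry. apply Nat.eqb_neq. pose proof (proj2_sig (Fin.to_nat i)).
      subst k pos. simpl in *. lia.
Qed.

Definition hull : structure s := {|
  dom := {d | in_hull d};
  dom_inh := inhabits (exist _ base (ex_intro _ nnil eq_refl));
  fint := fun f a => exist in_hull (fint M f (fun i => proj1_sig (a i)))
            (hull_fint f (fun i => proj1_sig (a i)) (fun i => proj2_sig (a i)));
  rint := fun r a => rint M r (fun i => proj1_sig (a i)) |}.

Lemma eval_hull (rho : nat -> dom hull) t :
  proj1_sig (eval hull rho t) = eval M (fun k => proj1_sig (rho k)) t.
Proof.
  induction t as [x|f a IH]; simpl; auto.
  f_equal. extensionality i. apply IH.
Qed.

Lemma hull_elementary p : forall rho : nat -> dom hull,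
  csat hull rho p <-> csat M (fun k => proj1_sig (rho k)) p.
Proof.
  assert (Hupd : forall (rho : nat -> dom hull) x (d : dom hull),
    (fun k => proj1_sig (upd hull rho x d k)) =
    upd M (fun k => proj1_sig (rho k)) x (proj1_sig d)).
  { intros rho x d. extensionality k. unfold upd. now destruct (Nat.eqb k x). }
  induction p as [|t1 t2|r a|q IH|q1 IH1 q2 IH2|x q IH]; simpl; intro rho.
  - reflexivity.
  - rewrite <- !eval_hull. split; [congruence|].
    destruct (eval hull rho t1), (eval hull rho t2); simpl. apply subset_eq_compat.
  - replace (fun i => proj1_sig (eval hull rho (a i)))
      with (fun i => eval M (fun k => proj1_sig (rho k)) (a i)); [reflexivity|].
    extensionality i. symmetry. apply eval_hull.
  - now rewrite IH.
  - now rewrite IH1, IH2.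
  - split.
    + intros [d Hd]. exists (proj1_sig d). apply IH in Hd. now rewrite Hupd in Hd.
    + intros [d Hd]. apply hull_witness in Hd as [e [He Hs]].
      * exists (exist _ e He). apply IH. now rewrite Hupd.
      * intro k. apply (proj2_sig (rho k)).
Qed.

Lemma hull_aut : aut_le_continuum hull.
Proof.
  apply countable_aut
    with (R := fun n a => exists w, ncode w = n /\ fst (interp w) = proj1_sig a).
  - intros n [a Ha] [b Hb] [w [Hw Ew]] [v [Hv Ev]]; simpl in *.
    apply subset_eq_compat. rewrite <- Hv in Hw. apply ncode_inj in Hw. congruence.
  - intros [a [w Hw]]. exists (ncode w). eauto.
Qed.

End Hull.

Theorem downward_Lowenheim_Skolem s (M : structure s) : countable_signature s ->
  exists N : structure s, aut_le_continuum N /\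
    forall p, (forall rho, csat M rho p) -> forall rho, csat N rho p.
Proof.
  intros [[ef Hef] [er Her]]. exists (hull M). split.
  - now apply hull_aut with ef er.
  - intros p H rho. now apply hull_elementary.
Qed.

(** * Compactness and expressive power *)

Theorem L_compact s : countable_signature s -> aleph0_compact s.
Proof.
  intros Hs T _ [e He] Hfin.
  (* Either all finite parts of [T] have models of [P], or all of them have models of
     its negation. *)
  assert (Hb : exists b : bool, forall l, (forall p, In p l -> T p) ->
    exists M : structure s, (b = true <-> aut_le_continuum M) /\
      forall p, In p l -> models M p).
  { apply NNPP. intro H.
    assert (Hl : forall b : bool, exists l, (forall p, In p l -> T p) /\
      forall M : structure s, (b = true <-> aut_le_continuum M) ->
        ~ forall p, In p l -> models M p).
    { intro b. apply NNPP. intro Hn. apply H. exists b. intros l Hl.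
      apply NNPP. intro Hm. apply Hn. exists l. split; auto.
      intros M Hb HM. apply Hm. eauto. }
    (* A model of both bad lists together decides [P] one way or the other, and either way
       contradicts one of them. *)
    destruct (Hl true) as [l1 [T1 N1]], (Hl false) as [l2 [T2 N2]].
    destruct (Hfin (l1 ++ l2)) as [M HM].
    - intros p Hp. apply in_app_or in Hp as []; auto.
    - destruct (classic (aut_le_continuum M)) as [HP|HP].
      + apply (N1 M); [tauto|]. intros p Hp. apply HM, in_or_app. auto.
      + apply (N2 M); [intuition discriminate|].
        intros p Hp. apply HM, in_or_app. auto. }
  destruct Hb as [b Hb].
  (* The countable theory is exhausted by its finite parts of code below [n]; [M n] will be a model
     of the [n]-th part. *)
  assert (Hlist : forall n, exists l, forall p, In p l <-> T p /\ e p < n).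
  { induction n as [|n [l Hl]].
    - exists nil. simpl. intuition lia.
    - destruct (classic (exists p, T p /\ e p = n)) as [[p [Hp Ep]]|Hn].
      + exists (p :: l). intro q. simpl. rewrite Hl. split.
        * intros [<-|[]]; auto with arith. split; auto. lia.
        * intros [Hq Hqn]. destruct (Nat.eq_dec (e q) n).
          -- left. apply He; congruence.
          -- right. split; auto. lia.
      + exists l. intro q. rewrite Hl. split; intros [Hq Hqn]; split; auto.
        assert (e q <> n) by eauto. lia. }
  assert (HM : forall n, exists M : structure s, (b = true <-> aut_le_continuum M) /\
    forall p, T p -> e p < n -> models M p).
  { intro n. destruct (Hlist n) as [l Hl]. destruct (Hb l) as [M [HMb HM]].
    - intros p Hp. now apply Hl.
    - exists M. split; auto. intros p Hp Hpn. apply HM, Hl. auto. }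
  set (M := fun n => proj1_sig (constructive_indefinite_description _ (HM n))).
  assert (Hspec : forall n, (b = true <-> aut_le_continuum (M n)) /\
    forall p, T p -> e p < n -> models (M n) p).
  { intro n. exact (proj2_sig (constructive_indefinite_description _ (HM n))). }
  destruct (limit_exists M) as [N [HN Hbig]].
  (* [p] holds in [M n] for all [n] above [e p], so its [core] passes to the limit. *)
  assert (HNT : forall p, T p -> forall rho, csat N rho (core b p)).
  { intros p Hp. apply HN. exists (e p). intros n Hn rho.
    apply core_sat; [right; apply Hspec|]. now apply Hspec. }
  destruct b.
  (* The limit itself may refute [P], but its countable elementary substructure satisfies [P], so
     there [core true] has the intended meaning. *)
  - destruct (downward_Lowenheim_Skolem N Hs) as [K [HK HNK]].
    exists K. intros p Hp rho. apply (core_sat (b := true)); [tauto|]. auto.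
  (* All [M n] refute [P] and are therefore infinite, so the limit refutes [P] as well. *)
  - exists N. intros p Hp rho. apply (core_sat (b := false)); [|auto].
    right. split; [discriminate|]. intro H. exfalso. revert H. apply Hbig.
    intro n. apply infinite_of_many_aut. intro H. apply Hspec in H. discriminate.
Qed.

Definition trivial_structure (s : signature) : structure s := {|
  dom := nat; dom_inh := inhabits 0; fint := fun _ _ => 0; rint := fun _ _ => False |}.

Theorem L_stronger s : L_stronger_than_FO s.
Proof.
  split.
  - intros K [p [[Hp _] HK]]. exists p. auto.
  - exists (@aut_le_continuum s). split.
    + exists fP. split; [intros x []|]. intro M. unfold models; simpl.
      split; auto. intro H. destruct (dom_inh M) as [d]. exact (H (fun _ => d)).
    + intros [p [[_ Hp] HK]].
      destruct (limit_exists (fun _ => trivial_structure s)) as [N [HN Hbig]].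
      apply Hbig; [intros _; now exists (fun n => n)|].
      (* Since [p] is free of [P], the value [true] is arbitrary, and [core_sat] applies to the
         limit and to the countable structure alike. *)
      apply HK. intro rho. apply (core_sat (b := true)); [auto|].
      apply HN. exists 0. intros n _ rho'. apply core_sat; [auto|].
      apply HK. apply countable_aut with (R := fun n a => n = a); [congruence|].
      intro a. now exists a.
Qed.

Theorem theorem6p1 (s : signature) (Hs : countable_signature s) :
  L_stronger_than_FO s /\ aleph0_compact s.
Proof. split; [apply L_stronger|now apply L_compact]. Qed.
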